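(* Consider an instance of the weighted $k$-server problem on a uniform metric space with weights $\beta_1,\dots,\beta_k>0$, and a randomized memoryless algorithm which moves its $i$-th server with probability $p_i>0$ (whenever the requested point is not occupied by its servers), where $p_1\ge p_2\ge\cdots\ge p_k$. Then the competitive ratio of this algorithm against an online adaptive adversary is at most \[\tilde{\alpha}(\beta,p)=\Big(\sum_{j=1}^kp_j\beta_j\Big)\max_{i\in[k]}\frac{\mathbf{I}^{[k]\setminus\{i\}}_{[k]}(p)}{p_i\beta_i}.\]
   Context: Weighted $k$-server problem on uniform metric spaces: any two distinct points are at distance $1$; $k$ servers with weights $\beta_i$; moving server $i$ costs $\beta_i$; each online request (a point) must be served by having a server there. A memoryless algorithm with distribution $(p_1,\dots,p_k)$ moves server $i$ to an unoccupied requested point with probability $p_i$, independently of the past. An online adaptive adversary generates each request after seeing the algorithm's previous behaviour and serves it immediately with its own servers of the same weights; $c$-competitive means $\mathbb{E}[\text{ALG}]\le c\,\mathbb{E}[\text{ADV}]+b$ for a constant $b$ and all such adversaries. Potentials and currents. Write $[m]=\{1,\dots,m\}$. For positive reals $p_1,p_2,\dots$ and each finite $S\subseteq\mathbb{N}$, a real number $\varphi_S(p)$ (depending only on $p_1,\dots,p_{\max S}$) is defined by induction on the largest element of $S$. For $T$ finite and $i\in T$ write $\mathbf{I}^{T\setminus\{i\}}_T(p)=p_i\big(\varphi_T(p)-\varphi_{T\setminus\{i\}}(p)\big)$. Set $\varphi_\emptyset(p)=0$. Given $\varphi_T$ for all $T\subseteq[k-1]$, let the numbers $f_S(p)$, $S\subseteq[k]$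 with $k\in S$, be the unique solution of the (strictly diagonally dominant) linear system: for $S\ne[k]$, with $i<k$ the smallest element of $[k]\setminus S$, $\big(p_i+\sum_{j\in S}p_j\big)f_S(p)=p_if_{S\cup\{i\}}(p)+\sum_{j\in S\setminus\{k\}}p_jf_{S\setminus\{j\}}(p)$; and $f_{[k]}(p)=1+\sum_{j=1}^{k-1}\mathbf{I}^{[k-1]\setminus\{j\}}_{[k-1]}(p)$. Then for $S\subseteq[k]$ with $k\in S$ define $\varphi_S(p)=\varphi_{S\setminus\{k\}}(p)+f_S(p)/p_k$. *)

(* Defs.v *)
From mathcomp Require Import all_boot all_order all_algebra.
From mathcomp Require Import all_classical all_reals.

Set Implicit Arguments.
Unset Strict Implicit.
Unset Printing Implicit Defensive.

Import Order.TTheory GRing.Theory Num.Theory.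
Local Open Scope ring_scope.

(* The index set [k] = {1, ..., k} is rendered as 'I_k, so all indices are
   shifted by one; in 'I_n.+1, ord_max is the element k = n + 1 and
   'I_n embeds as [k - 1] through [widen]. *)
Definition widen (n : nat) (i : 'I_n) : 'I_n.+1 := widen_ord (leqnSn n) i.

(* I_T^{T \ {i}}, for a given potential phi. *)
Definition current_of (R : realType) (n : nat) (p : 'I_n -> R)
    (phi : {set 'I_n} -> R) (T : {set 'I_n}) (i : 'I_n) : R :=
  p i * (phi T - phi (T :\ i)).

(* The linear system defining (f_S)_S at stage k = n.+1, where phi is the
   potential on the subsets of [k - 1]. The unknowns are the f_S with k in S;
   the first clause only fixes the unused entries, so that the solution is
   unique as a total function of S. *)
Definition potential_system (R : realType) (n : nat) (p : 'I_n.+1 -> R)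
    (phi : {set 'I_n} -> R) (f : {ffun {set 'I_n.+1} -> R}) : Prop :=
  [/\ forall S : {set 'I_n.+1}, ord_max \notin S -> f S = 0,
      forall (S : {set 'I_n.+1}) (i : 'I_n.+1),
        ord_max \in S -> i \notin S ->
        (forall j : 'I_n.+1, j \notin S -> (i <= j)%N) ->
        (p i + \sum_(j in S) p j) * f S =
        p i * f (i |: S) + \sum_(j in S :\ ord_max) p j * f (S :\ j)
    & f [set: 'I_n.+1] =
        1 + \sum_(j < n) current_of (p \o @widen n) phi [set: 'I_n] j].

Definition potential_increment (R : realType) (n : nat) (p : 'I_n.+1 -> R)
    (phi : {set 'I_n} -> R) : {ffun {set 'I_n.+1} -> R} :=
  xget [ffun=> 0] (potential_system p phi).

(* phi_S(p) for S a subset of [k]; the recursion makes it depend only on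
   p_1, ..., p_(max S). *)
Fixpoint potential (R : realType) (k : nat) :
    ('I_k -> R) -> {set 'I_k} -> R :=
  match k with
  | 0 => fun _ _ => 0
  | n.+1 => fun p S =>
      let phi := potential (p \o @widen n) in
      let S' := [set i : 'I_n | widen i \in S] in
      if ord_max \in S
      then phi S' + potential_increment p phi S / p ord_max
      else phi S'
  end.

Definition current (R : realType) (k : nat) (p : 'I_k -> R)
    (T : {set 'I_k}) (i : 'I_k) : R :=
  current_of p (potential p) T i.

(* The index set is nonempty, so seeding the iterated maximum with the value at
   the first index gives the plain maximum. *)
Definition alpha_tilde (R : realType) (n : nat) (beta p : 'I_n.+1 -> R) : R :=
  let ratio i := current p [set: 'I_n.+1] i / (p i * beta i) in
  (\sum_(j < n.+1) p j * beta j) *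
  \big[Num.max/ratio ord0]_(i < n.+1) ratio i.

Definition config (k : nat) (X : eqType) : Type := 'I_k -> X.

Definition uniform_dist (R : realType) (X : eqType) (x y : X) : R :=
  (x != y)%:R.

Definition move_cost (R : realType) (k : nat) (X : eqType) (beta : 'I_k -> R)
    (a a' : config k X) : R :=
  \sum_(i < k) beta i * uniform_dist R (a i) (a' i).

Definition occupied (k : nat) (X : eqType) (a : config k X) (r : X) : bool :=
  [exists i, a i == r].

(* The memoryless algorithm's answer to the request r when its random choice of
   a server is i; the choice is ignored if r is already occupied. *)
Definition alg_step (k : nat) (X : eqType) (a : config k X) (r : X) (i : 'I_k) :
    config k X :=
  if occupied a r then a else fun j => if j == i then r else a j.

(* An online adaptive adversary. Its argument is the sequence of the
   algorithm's configurations after each of the previous requests. It either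
   stops (None) or issues a request r together with its own new configuration,
   which must serve r; so r is served before the algorithm's answer to r is
   known. *)
Record adversary (k : nat) (X : eqType) : Type := Adversary {
  adv_next :> seq (config k X) -> option (X * config k X);
  adv_serves : forall h r d, adv_next h = Some (r, d) -> occupied d r }.

(* The costs (ALG, ADV) when w lists the algorithm's random choices, one for
   each request; h is the history shown to the adversary, a and d are the
   current configurations of the algorithm and of the adversary. *)
Fixpoint run_cost (R : realType) (k : nat) (X : eqType) (beta : 'I_k -> R)
    (A : adversary k X) (h : seq (config k X)) (a d : config k X)
    (w : seq 'I_k) : R * R :=
  if w is i :: w' then
    if A h is Some (r, d') then
      let a' := alg_step a r i in
      let rest := run_cost beta A (rcons h a') a' d' w' in
      (move_cost beta a a' + rest.1, move_cost beta d d' + rest.2)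
    else (0, 0)
  else (0, 0).

(* Expectation when N servers are drawn independently with distribution p. *)
Definition expectation (R : realType) (k N : nat) (p : 'I_k -> R)
    (F : N.-tuple 'I_k -> R) : R :=
  \sum_(w : N.-tuple 'I_k) (\prod_(t < N) p (tnth w t)) * F w.

(* The algorithm and the adversary start from the same configuration a0, N
   bounds the number of requests, and the constant b depends neither on a0,
   nor on the adversary, nor on N. *)
Definition competitive (R : realType) (k : nat) (X : eqType)
    (beta p : 'I_k -> R) (c : R) : Prop :=
  exists b : R, forall (a0 : config k X) (A : adversary k X) (N : nat),
    expectation p (fun w : N.-tuple 'I_k => (run_cost beta A [::] a0 a0 w).1)
    <= c * expectation p
             (fun w : N.-tuple 'I_k => (run_cost beta A [::] a0 a0 w).2) + b.

(* Main.v *)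
(**
Let S be the set of indices i at which the servers of the algorithm and of the
adversary agree, and let P = \sum_j p_j beta_j be the expected cost of an answer
to an unoccupied request. The argument is a potential one, with the potential
P * (phi_[k] - phi_S).

The defining system says exactly that, when the adversary always requests the
position of its mismatched server of least index, phi_S has drift 1: for i the
least element outside S,
  p_i (phi_(S + i) - phi_S) = 1 + \sum_(j in S) p_j (phi_S - phi_(S - j)).
Minimum principles for this chain then show, in this order, that phi is
monotone, that p_i (phi_(S + i) - phi_S) is nondecreasing in i outside S (so
that every other request gives a drift of at least 1), and that phi is
supermodular. By supermodularity a move of the adversary's server i lowers phi
by at most phi_[k] - phi_([k] - i) = I_[k]^([k] - i) / p_i.
*)

Require Import Defs.
From mathcomp Require Import all_boot all_order all_algebra.
From mathcomp Require Import all_classical all_reals.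
From mathcomp Require Import fintype finset ring lra.
Import Order.TTheory GRing.Theory Num.Theory.
Local Open Scope ring_scope.

Set Implicit Arguments.
Unset Strict Implicit.
Unset Printing Implicit Defensive.

(** * Minimum principle and diagonally dominant linear systems *)

(** By finiteness a negative value forces a negative minimum. The predicate lets later arguments
    range over nested pairs or triples of a set and two indices. *)
Lemma minimum_principle (R : realDomainType) (T : finType) (P : pred T)
    (f : T -> R) :
  (forall x, P x -> f x < 0 -> (forall y, P y -> f x <= f y) -> False) ->
  forall x, P x -> 0 <= f x.
Proof.
move=> no_min x Px.
case: (@arg_minP _ _ _ x P f Px) => y Py ymin.
apply: le_trans (ymin x Px); rewrite leNgt; apply/negP => fy.
exact: no_min Py fy ymin.
Qed.

Lemma solvable_of_injective (R : fieldType) (T : finType) (a : T -> T -> R)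
    (b : T -> R) :
  (forall x : T -> R, (forall s, \sum_t a s t * x t = 0) -> forall s, x s = 0) ->
  exists x : {ffun T -> R}, forall s, \sum_t a s t * x t = b s.
Proof.
move=> inj_a.
(* The coefficient matrix is transposed, since row vectors act from the left. *)
pose M := \matrix_(i < #|T|, j < #|T|) a (enum_val j) (enum_val i).
have sumM (v : 'rV_#|T|) s :
    \sum_t a s t * v 0 (enum_rank t) = (v *m M) 0 (enum_rank s).
  rewrite mxE (reindex_onto (@enum_val T predT) enum_rank) /=; last first.
    by move=> t _; rewrite enum_rankK.
  apply: eq_big => [i|i _]; first by rewrite enum_valK eqxx.
  by rewrite mxE enum_rankK enum_valK mulrC.
have Mu : M \in unitmx.
  rewrite -row_free_unit; apply: inj_row_free => v vM0.
  apply/rowP => i; rewrite mxE -(enum_valK i).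
  by apply: (inj_a (fun t => v 0 (enum_rank t))) => s; rewrite sumM vM0 mxE.
pose v := (\row_i b (enum_val i)) *m invmx M.
exists [ffun t => v 0 (enum_rank t)] => s.
under eq_bigr do rewrite ffunE.
by rewrite sumM mulmxKV // mxE enum_rankK.
Qed.

(** A nonzero solution of the homogeneous system would violate dominance at an entry of largest
    modulus. *)
Lemma diag_dominant_solvable (R : realFieldType) (T : finType) (c : T -> R)
    (a : T -> T -> R) (b : T -> R) :
  (forall s t, 0 <= a s t) -> (forall s, \sum_t a s t < c s) ->
  exists x : {ffun T -> R}, forall s, c s * x s = \sum_t a s t * x t + b s.
Proof.
move=> a0 ac.
have sumE (x : T -> R) s :
    \sum_t (c s * (t == s)%:R - a s t) * x t = c s * x s - \sum_t a s t * x t.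
  under eq_bigr do rewrite mulrBl -mulrA.
  rewrite sumrB -mulr_sumr (bigD1 s) //= eqxx mul1r big1 ?addr0 // => t /negPf ->.
  by rewrite mul0r.
have [|x xP] := @solvable_of_injective R T (fun s t => c s * (t == s)%:R - a s t) b.
  move=> x x0 s; apply/eqP; rewrite -normr_le0 -oppr_ge0.
  apply: (@minimum_principle R T predT (fun s => - `|x s|)) => // {}s _.
  rewrite oppr_lt0 => xs smax.
  have c0 : 0 < c s by apply: le_lt_trans (ac s); apply: sumr_ge0.
  have: c s * `|x s| <= (\sum_t a s t) * `|x s|.
    rewrite -[X in X * _ <= _](ger0_norm (ltW c0)) -normrM.
    have := x0 s; rewrite sumE => /eqP; rewrite subr_eq0 => /eqP ->.
    apply: (le_trans (ler_norm_sum _ _ _)); rewrite mulr_suml.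
    apply: ler_sum => t _; rewrite normrM ger0_norm // ler_wpM2l //.
    by rewrite -lerN2 smax.
  by rewrite leNgt ltr_pM2r // ac.
exists x => s; have := xP s; rewrite sumE => <-.
by rewrite addrC subrK.
Qed.

(** * Least missing indices and solvability of the defining system *)

Definition least_missing (n : nat) (S : {set 'I_n}) (i : 'I_n) : Prop :=
  i \notin S /\ forall j, j \notin S -> (i <= j)%N.

Lemma least_missing_exists (n : nat) (S : {set 'I_n}) :
  S != [set: 'I_n] -> exists i, least_missing S i.
Proof.
rewrite -subTset => /subsetPn[x _ xS].
case: (@arg_minnP _ x (fun i => i \notin S) (fun i => i : nat) xS) => i iS imin.
by exists i.
Qed.

Lemma least_missing_proper (n : nat) (S : {set 'I_n}) (i : 'I_n) :
  least_missing S i -> S != [set: 'I_n].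
Proof. by move=> [iS _]; apply: contraNneq iS => ->; rewrite inE. Qed.

Lemma least_missing_uniq (n : nat) (S : {set 'I_n}) (i j : 'I_n) :
  least_missing S i -> least_missing S j -> i = j.
Proof.
move=> [iS imin] [jS jmin]; apply/val_inj/eqP.
by rewrite eqn_leq imin // jmin.
Qed.

(** Every set gets a row; outside [act] it prescribes [f S] outright. In the other rows dominance is
    strict by [p ord_max], since [ord_max] counts on the diagonal but is never deleted. *)
Lemma potential_system_solvable (R : realType) (n : nat) (p : 'I_n.+1 -> R)
    (phi : {set 'I_n} -> R) :
  (forall i, 0 < p i) -> exists f, potential_system p phi f.
Proof.
move=> p0.
pose F := 1 + \sum_(j < n) current_of (p \o @widen n) phi [set: 'I_n] j.
(* The default is harmless: rows use [m S] only when [S] is not full, where a least missing index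
   exists. *)
pose m S := xget ord_max (@least_missing n.+1 S).
pose act (S : {set 'I_n.+1}) := (ord_max \in S) && (S != setT).
pose a (S T : {set 'I_n.+1}) := if act S then p (m S) * (T == m S |: S)%:R +
  \sum_(j in S :\ ord_max) p j * (T == S :\ j)%:R else 0.
pose c S := if act S then p (m S) + \sum_(j in S) p j else 1.
pose b (S : {set 'I_n.+1}) := if S == setT then F else 0.
have sum_delta (U : {set 'I_n.+1}) (g : {set 'I_n.+1} -> R) (x : R) :
    \sum_T x * (T == U)%:R * g T = x * g U.
  rewrite (bigD1 U) //= eqxx mulr1 big1 ?addr0 // => T /negPf ->.
  by rewrite mulr0 mul0r.
have sumA S g : act S -> \sum_T a S T * g T =
    p (m S) * g (m S |: S) + \sum_(j in S :\ ord_max) p j * g (S :\ j).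
  rewrite /a => ->; under eq_bigr do rewrite mulrDl mulr_suml.
  rewrite big_split /= sum_delta exchange_big /=; congr (_ + _).
  by apply: eq_bigr => j _; rewrite sum_delta.
have [S T|S|f fP] := @diag_dominant_solvable R _ c a b.
- rewrite /a; case: ifP => // _; rewrite addr_ge0 //.
    by rewrite mulr_ge0 // ltW.
  by apply: sumr_ge0 => j _; rewrite mulr_ge0 // ltW.
- have [Sact|/negPf Sact] := boolP (act S); last first.
    by rewrite /a /c Sact big1.
  have := sumA S (fun=> 1) Sact; under eq_bigr do rewrite mulr1.
  move=> ->; rewrite /c Sact mulr1 ltrD2l.
  have /andP[maxS _] := Sact.
  rewrite [X in _ < X](big_setD1 ord_max) //=.
  under eq_bigr do rewrite mulr1.
  by rewrite ltrDr.
have fixS S : ~~ act S -> f S = b S.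
  move=> /negPf Sact; have := fP S; rewrite /c /a Sact mul1r => ->.
  by under eq_bigr do rewrite mul0r; rewrite big1 ?add0r.
exists f; split.
- move=> S maxS; rewrite fixS /act ?(negPf maxS) // /b.
  by case: eqP maxS => // ->; rewrite inE.
- move=> S i maxS iS imin.
  have Sp : S != setT by apply: (@least_missing_proper _ _ i).
  have Sact : act S by rewrite /act maxS.
  have -> : i = m S.
    apply: (@least_missing_uniq _ S) => //; apply: xgetPex.
    exact: least_missing_exists.
  have := fP S; rewrite sumA // {1}/c Sact /b (negPf Sp) addr0.
  by [].
- by rewrite fixS ?/b ?eqxx // /act eqxx andbF.
Qed.

(* The summands with l outside S vanish. *)
Definition outflow (R : realType) (n : nat) (p : 'I_n -> R)
    (phi : {set 'I_n} -> R) (S : {set 'I_n}) : R :=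
  \sum_l p l * (phi S - phi (S :\ l)).

Definition balanced (R : realType) (n : nat) (p : 'I_n -> R)
    (phi : {set 'I_n} -> R) : Prop :=
  forall S i, least_missing S i ->
    p i * (phi (i |: S) - phi S) = 1 + outflow p phi S.

Definition monotone (R : realType) (n : nat) (phi : {set 'I_n} -> R) : Prop :=
  forall S S' : {set 'I_n}, S \subset S' -> phi S <= phi S'.

(** * The solutions of the potential system *)

Section PotentialSystem.

Variables (R : realType) (n : nat) (p : 'I_n.+1 -> R).
Variables (phi : {set 'I_n} -> R) (f : {ffun {set 'I_n.+1} -> R}).
Hypothesis p_gt0 : forall i, 0 < p i.
Hypothesis f_sys : potential_system p phi f.
Hypothesis f_setT_ge0 : 0 <= f [set: 'I_n.+1].

Lemma system_D1_max (S : {set 'I_n.+1}) : f (S :\ ord_max) = 0.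
Proof. by have [f0 _ _] := f_sys; rewrite f0 // setD11. Qed.

(* Since f vanishes at S :\ ord_max, the term p_k f_S of the system becomes the
   summand of the outflow at l = ord_max. *)
Lemma system_outflow (S : {set 'I_n.+1}) (i : 'I_n.+1) :
  ord_max \in S -> least_missing S i ->
  outflow p f S = p i * (f (i |: S) - f S).
Proof.
move=> maxS [iS imin]; have [f0 fE _] := f_sys.
have := fE S i maxS iS imin; rewrite mulrDl => E.
rewrite /outflow (bigID (mem S)) /= [X in _ + X]big1 ?addr0; last first.
  move=> l lS; suff -> : S :\ l = S by rewrite subrr mulr0.
  by apply/setDidPl; rewrite disjoint_sym disjoints1.
rewrite (big_setD1 ord_max) //= system_D1_max subr0.
under eq_bigr do rewrite mulrBr.
rewrite sumrB -mulr_suml addrA -mulrDl -(big_setD1 ord_max) //=.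
by rewrite mulrBr; lra.
Qed.

(** At a negative minimum the summand at [ord_max] makes the outflow negative, whereas the system
    equates it to [p i * (f (i |: S) - f S)], nonnegative by minimality. *)
Lemma system_ge0 (S : {set 'I_n.+1}) : 0 <= f S.
Proof.
have [f0 _ _] := f_sys.
apply: (@minimum_principle R _ predT f) => // {}S _ fS fmin.
have maxS : ord_max \in S by apply: contraTT fS => /f0 ->; rewrite ltxx.
have [i iS] : exists i, least_missing S i.
  by apply: least_missing_exists; apply: contraTneq fS => ->; rewrite -leNgt.
have : outflow p f S < 0.
  rewrite /outflow (bigD1 ord_max) //= system_D1_max subr0.
  rewrite addrC -oppr_gt0 opprD ltr_wpDl ?oppr_ge0 //; last first.
    by rewrite oppr_gt0 pmulr_rlt0.
  by apply: sumr_le0 => l _; rewrite pmulr_rle0 // subr_le0 fmin.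
rewrite (system_outflow maxS iS) pmulr_rlt0 // subr_lt0 => /lt_geF.
by rewrite fmin.
Qed.

Lemma system_monotone : monotone f.
Proof.
have [f0 _ _] := f_sys.
move=> S S' SS'; rewrite -subr_ge0.
(* At a pair with f S' - f S negative and minimal, every summand of
   outflow p f S' - outflow p f S is nonpositive and the one at ord_max is
   negative, while the upward terms pull the other way. *)
pose P (U : {set 'I_n.+1} * {set 'I_n.+1}) := U.1 \subset U.2.
apply: (@minimum_principle R _ P (fun U => f U.2 - f U.1) _ (S, S')) => //.
move=> [{SS'}S {}S']; rewrite {}/P /= => SS' neg min_f.
have {}min_f (T T' : {set 'I_n.+1}) : T \subset T' -> f S' - f S <= f T' - f T.
  by move=> TT'; apply: (min_f (T, T')).
have maxS : ord_max \in S.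
  by apply: contraTT neg => /f0 ->; rewrite subr0 -leNgt system_ge0.
have maxS' : ord_max \in S' by apply: (subsetP SS').
have [i iS] : exists i, least_missing S i.
  apply: least_missing_exists; apply: contraTneq neg => SE.
  have -> : S' = S by apply/eqP; rewrite eqEsubset SS' SE subsetT.
  by rewrite subrr ltxx.
have fi : f (i |: S) - f S = f S' - f S - (f S' - f (i |: S)) by ring.
(* The full set has no equation, but the outflow at [S] alone is positive because [f S] exceeds
   [f S']. So adding [i] raises [f] and yields a nested pair with a smaller difference. *)
have [S'T | /least_missing_exists[i' iS']] := eqVneq S' setT.
  have : 0 < outflow p f S.
    rewrite /outflow (bigD1 ord_max) //= system_D1_max subr0 ltr_pwDl //.
      rewrite mulr_gt0 //; apply: le_lt_trans (_ : f S' < _).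
        exact: system_ge0.
      by rewrite -subr_lt0.
    apply: sumr_ge0 => l _; rewrite pmulr_rge0 //.
    have := min_f (S :\ l) S'; rewrite S'T subsetT => /(_ isT); lra.
  rewrite (system_outflow maxS iS) pmulr_rgt0 // fi.
  by rewrite S'T ltNge subr_le0 -S'T min_f // S'T subsetT.
have : outflow p f S' - outflow p f S < 0.
  rewrite /outflow -sumrB (bigD1 ord_max) //= !system_D1_max !subr0.
  rewrite addrC -oppr_gt0 opprD ltr_wpDl ?oppr_ge0 //; last first.
    by rewrite oppr_gt0 -mulrBr pmulr_rlt0.
  apply: sumr_le0 => l _; rewrite -mulrBr pmulr_rle0 //.
  by have := min_f _ _ (setSD [set l] SS'); lra.
rewrite (system_outflow maxS iS) (system_outflow maxS' iS').
have [ii | ii] := eqVneq i i'.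
  rewrite -ii -mulrBr pmulr_rlt0 //.
  by have := min_f _ _ (setUS [set i] SS'); lra.
(* Hence [(S, i' |: S')] and [(i |: S, S')] are both nested pairs, to which minimality applies. *)
have iS'in : i \in S'.
  apply: contraNT ii => iS'n; apply/eqP/val_inj/eqP.
  have [[iSn imin] [iS'n' imin']] := (iS, iS').
  rewrite eqn_leq imin' // imin //.
  by apply: contra iS'n'; apply: (subsetP SS').
have : 0 <= p i' * (f (i' |: S') - f S').
  by rewrite pmulr_rge0 //; have := min_f _ _ (subset_trans SS' (subsetUr [set i'] S')); lra.
have : p i * (f (i |: S) - f S) <= 0.
  rewrite pmulr_rle0 //; have := min_f (i |: S) S'.
  by rewrite subUset sub1set iS'in => /(_ SS'); lra.
lra.
Qed.

End PotentialSystem.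

(** * Balance and monotonicity of the potential *)

Definition restrict (n : nat) (S : {set 'I_n.+1}) : {set 'I_n} :=
  [set i : 'I_n | widen i \in S].

Lemma widen_neq_max (n : nat) (i : 'I_n) : (widen i == ord_max) = false.
Proof. by apply/eqP => /(congr1 val) /= iE; have := ltn_ord i; rewrite iE ltnn. Qed.

Lemma widen_inj (n : nat) : injective (@widen n).
Proof. by move=> i j /(congr1 val) /= ij; apply: val_inj. Qed.

Lemma ord_maxVwiden (n : nat) (i : 'I_n.+1) :
  i = ord_max \/ exists j : 'I_n, i = widen j.
Proof.
case: (unliftP ord_max i) => [j ->|->]; [right | by left].
by exists j; apply: val_inj; apply: lift_max.
Qed.

Lemma restrictU1 (n : nat) (S : {set 'I_n.+1}) (i : 'I_n) :
  restrict (widen i |: S) = i |: restrict S.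
Proof. by apply/setP => j; rewrite !inE (inj_eq (@widen_inj n)). Qed.

Lemma restrictD1 (n : nat) (S : {set 'I_n.+1}) (i : 'I_n) :
  restrict (S :\ widen i) = restrict S :\ i.
Proof. by apply/setP => j; rewrite !inE (inj_eq (@widen_inj n)). Qed.

Lemma restrictU1_max (n : nat) (S : {set 'I_n.+1}) :
  restrict (ord_max |: S) = restrict S.
Proof. by apply/setP => j; rewrite !inE widen_neq_max. Qed.

Lemma restrictD1_max (n : nat) (S : {set 'I_n.+1}) :
  restrict (S :\ ord_max) = restrict S.
Proof. by apply/setP => j; rewrite !inE widen_neq_max. Qed.

Lemma restrictS (n : nat) (S S' : {set 'I_n.+1}) :
  S \subset S' -> restrict S \subset restrict S'.
Proof. by move=> /subsetP SS'; apply/subsetP => j; rewrite !inE => /SS'. Qed.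

Lemma potential_incrementP (R : realType) (n : nat) (p : 'I_n.+1 -> R)
    (phi : {set 'I_n} -> R) :
  (forall i, 0 < p i) -> potential_system p phi (potential_increment p phi).
Proof. by move=> p0; apply: xgetPex; apply: potential_system_solvable. Qed.

Lemma potentialS (R : realType) (n : nat) (p : 'I_n.+1 -> R)
    (S : {set 'I_n.+1}) :
  (forall i, 0 < p i) ->
  potential p S = potential (p \o @widen n) (restrict S) +
    potential_increment p (potential (p \o @widen n)) S / p ord_max.
Proof.
move=> p0 /=; case: ifPn => // maxS.
have [f0 _ _] := potential_incrementP (potential (p \o @widen n)) p0.
by rewrite f0 // mul0r addr0.
Qed.

Lemma outflow_ge0 (R : realType) (n : nat) (p : 'I_n -> R)
    (phi : {set 'I_n} -> R) (S : {set 'I_n}) :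
  (forall i, 0 < p i) -> monotone phi -> 0 <= outflow p phi S.
Proof.
move=> p0 mono; apply: sumr_ge0 => l _.
by rewrite mulr_ge0 ?subr_ge0 ?mono ?subsetDl // ltW.
Qed.

(** The prescribed value is 1 plus the outflow of [phi] at the full set. *)
Lemma increment_setT_ge0 (R : realType) (n : nat) (p : 'I_n.+1 -> R)
    (phi : {set 'I_n} -> R) (f : {ffun {set 'I_n.+1} -> R}) :
  (forall i, 0 < p i) -> monotone phi -> potential_system p phi f ->
  0 <= f [set: 'I_n.+1].
Proof.
move=> p0 mono [_ _ ->]; rewrite addr_ge0 //.
by apply: (@outflow_ge0 _ _ (p \o @widen n)) => // i; apply: p0.
Qed.

Lemma potential_monotone (R : realType) (n : nat) (p : 'I_n -> R) :
  (forall i, 0 < p i) -> monotone (potential p).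
Proof.
elim: n p => [|n IHn] p p0 S S' SS' //.
have mono := IHn (p \o @widen n) (fun i => p0 _).
have sys := potential_incrementP (potential (p \o @widen n)) p0.
rewrite !potentialS // lerD ?mono ?restrictS // ler_pM2r ?invr_gt0 //.
by apply: (system_monotone p0 sys) => //; apply: increment_setT_ge0 mono sys.
Qed.

(** The outflow splits into that of the lower potential and that of [f / p ord_max]. If [ord_max] is
    in [S], the system and the induction hypothesis add up. Otherwise [f] vanishes at [S] and below,
    and for [S] = [k - 1] the prescribed value of [f] at the full set is exactly balance. *)
Lemma potential_balanced (R : realType) (n : nat) (p : 'I_n -> R) :
  (forall i, 0 < p i) -> balanced p (potential p).
Proof.
elim: n p => [|n IHn] p p0 S i iS; first by case: i iS.
set q := p \o @widen n.
have bal : balanced q (potential q) by apply: IHn => j; apply: p0.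
have sys := potential_incrementP (potential q) p0.
set f := potential_increment p (potential q) in sys.
have pE (T : {set 'I_n.+1}) : potential p T = potential q (restrict T) + f T / p ord_max.
  exact: potentialS.
move: (potential p) pE => P pE.
have outE : outflow p P S =
    outflow q (potential q) (restrict S) + outflow p f S / p ord_max.
  rewrite /outflow [in RHS]mulr_suml big_ord_recr [X in _ = _ + X]big_ord_recr /=.
  rewrite addrA -big_split /=; congr (_ + _).
    by apply: eq_bigr => l _; rewrite !pE restrictD1 /q /=; ring.
  by rewrite !pE restrictD1_max; ring.
rewrite outE; have [f0 _ fT] := sys; have [iSn imin] := iS.
have pmax := lt0r_neq0 (p0 ord_max).
have [maxS|maxS] := boolP (ord_max \in S).
  have [iE|[j jE]] := ord_maxVwiden i; first by rewrite iE maxS in iSn.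
  have jS : least_missing (restrict S) j.
    split=> [|l]; first by rewrite inE -jE.
    by rewrite inE => /imin; rewrite jE.
  rewrite (system_outflow sys maxS iS) addrA -(bal _ _ jS) !pE jE restrictU1.
  by rewrite /q /=; ring.
have -> : outflow p f S = 0.
  apply: big1 => l _; rewrite !f0 ?subrr ?mulr0 //.
  by rewrite inE negb_and maxS orbT.
rewrite mul0r addr0 !pE (f0 S) // mul0r addr0.
have [iE|[j jE]] := ord_maxVwiden i.
  have ST : restrict S = setT.
    apply/setP => l; rewrite !inE; apply/negPn/negP => /imin.
    by rewrite iE /= leqNgt ltn_ord.
  have -> : i |: S = setT.
    apply/setP => l; rewrite !inE; have [->|[k ->]] := ord_maxVwiden l.
      by rewrite iE eqxx.
    by have := in_setT k; rewrite -ST inE => ->; rewrite orbT.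
  rewrite iE fT -[restrict S]restrictU1_max.
  have -> : restrict (ord_max |: S) = setT by rewrite restrictU1_max.
  have -> : restrict setT = setT :> {set 'I_n} by apply/setP => l; rewrite !inE.
  by rewrite /outflow addrAC subrr add0r mulrC divfK.
have jS : least_missing (restrict S) j.
  split=> [|l]; first by rewrite inE -jE.
  by rewrite inE => /imin; rewrite jE.
rewrite f0 ?mul0r ?addr0; last first.
  by rewrite jE !inE eq_sym widen_neq_max.
by rewrite -(bal _ _ jS) jE restrictU1.
Qed.

(** * Supermodularity of balanced potentials *)

(** A discrete derivative; iterated, it gives mixed second differences, whose nonnegativity is
    supermodularity. *)
Definition increment (R : realType) (n : nat) (phi : {set 'I_n} -> R)
    (x : 'I_n) (S : {set 'I_n}) : R :=
  phi (x |: S) - phi S.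

Section Balanced.

Variables (R : realType) (n : nat) (p : 'I_n -> R) (phi : {set 'I_n} -> R).
Hypothesis p_gt0 : forall i, 0 < p i.

(** Deleting [l] commutes with adding [x] unless [l = x], which contributes the first term. *)
Lemma outflowU1 (psi : {set 'I_n} -> R) (x : 'I_n) (S : {set 'I_n}) :
  x \notin S ->
  outflow p psi (x |: S) - outflow p psi S =
  p x * increment psi x S + outflow p (increment psi x) S.
Proof.
move=> xS; rewrite /outflow /increment -sumrB (bigD1 x) //=.
rewrite [in RHS](bigD1 x) //= setU1K //.
have -> : S :\ x = S by apply/setDidPl; rewrite disjoint_sym disjoints1.
rewrite !subrr !mulr0 subr0 add0r; congr (_ + _).
apply: eq_bigr => l lx; rewrite -mulrBr; congr (_ * _).
have -> : (x |: S) :\ l = x |: S :\ l.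
  by apply/setP => y; rewrite !inE; case: (eqVneq y x) => // ->; rewrite eq_sym lx.
by ring.
Qed.

Lemma increment_in (psi : {set 'I_n} -> R) (x : 'I_n) (S : {set 'I_n}) :
  x \in S -> increment psi x S = 0.
Proof.
move=> xS; rewrite /increment (_ : x |: S = S) ?subrr //.
by apply/setUidPr; rewrite sub1set.
Qed.

Lemma incrementC (i j : 'I_n) (S : {set 'I_n}) :
  increment (increment phi i) j S = increment (increment phi j) i S.
Proof. by rewrite /increment setUCA; ring. Qed.

Hypothesis phi_mono : monotone phi.
Hypothesis phi_bal : balanced p phi.

Lemma increment_ge0 (x : 'I_n) (S : {set 'I_n}) : 0 <= increment phi x S.
Proof. by rewrite subr_ge0 phi_mono ?subsetUr. Qed.

Lemma outflow_diff (S S' : {set 'I_n}) (m m' : 'I_n) :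
  least_missing S m -> least_missing S' m' ->
  outflow p phi S' - outflow p phi S =
  p m' * increment phi m' S' - p m * increment phi m S.
Proof. by move=> mS mS'; rewrite /increment !phi_bal //; ring. Qed.

Lemma least_missingU1 (S : {set 'I_n}) (m i : 'I_n) :
  m != i -> least_missing S m -> least_missing (i |: S) m.
Proof.
move=> mi [mS mmin]; split; first by rewrite !inE negb_or mi.
by move=> j; rewrite !inE negb_or => /andP[_ /mmin].
Qed.

Hypothesis p_noninc : forall i j : 'I_n, (i <= j)%N -> p j <= p i.

(** At a negative minimum of [gap], expanding the outflows by deletions makes the combination in
    [bound] negative, while balance makes it nonnegative. *)
Lemma scaled_increment_le (S : {set 'I_n}) (i i' : 'I_n) :
  (i <= i')%N -> i' \notin S ->
  p i * increment phi i S <= p i' * increment phi i' S.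
Proof.
move=> ii' i'S; rewrite -subr_ge0.
pose gap (T : {set 'I_n}) x y :=
  p y * increment phi y T - p x * increment phi x T.
pose P (U : {set 'I_n} * 'I_n * 'I_n) := (U.1.2 <= U.2)%N && (U.2 \notin U.1.1).
pose f (U : {set 'I_n} * 'I_n * 'I_n) := gap U.1.1 U.1.2 U.2.
apply: (@minimum_principle R _ P f _ (S, i, i')); last by rewrite /P /= ii'.
move=> [[{ii' i'S}S {}i] {}i']; rewrite {}/P {}/f /= => /andP[ii' i'S] neg fmin.
have {}fmin (T : {set 'I_n}) (x y : 'I_n) :
    (x <= y)%N -> y \notin T -> gap S i i' <= gap T x y.
  by move=> xy yT; apply: (fmin (T, x, y)); rewrite /= xy.
have iS : i \notin S.
  apply: contraTN neg => iS; rewrite -leNgt /gap.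
  by rewrite (increment_in _ iS) mulr0 subr0 mulr_ge0 ?increment_ge0 // ltW.
have i'i : i' != i.
  by apply: contraTneq neg => ->; rewrite /gap subrr ltxx.
have bound : p i' * (outflow p phi (i' |: S) - outflow p phi S)
    - p i * (outflow p phi (i |: S) - outflow p phi S) < 0.
  have out_gap : p i' * outflow p (increment phi i') S
      - p i * outflow p (increment phi i) S <= 0.
    rewrite /outflow !mulr_sumr -sumrB; apply: sumr_le0 => l _.
    have -> : p i' * (p l * (increment phi i' S - increment phi i' (S :\ l)))
        - p i * (p l * (increment phi i S - increment phi i (S :\ l)))
      = p l * (gap S i i' - gap (S :\ l) i i') by rewrite /gap; ring.
    by rewrite pmulr_rle0 // subr_le0 fmin // !inE negb_and i'S orbT.
  rewrite !outflowU1 //.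
  (* The leading terms are [p i * gap S i i'] minus this quantity; its sign is where the ordering of
     [p] enters. *)
  have : 0 <= p i' * (p i - p i') * increment phi i' S.
    by rewrite !mulr_ge0 ?increment_ge0 ?subr_ge0 ?p_noninc // ltW.
  have : p i * gap S i i' < 0 by rewrite pmulr_rlt0.
  by rewrite /gap; lra.
have [m mS] : exists m, least_missing S m.
  by apply: least_missing_exists; apply: contraNneq iS => ->; rewrite inE.
have [mSn mmin] := mS; have mi := mmin i iS.
have im' : m != i' by apply: contraNneq i'i => mi'; rewrite -val_eqE eqn_leq ii' -mi' mi.
move: bound; apply/negP; rewrite -leNgt (outflow_diff mS (least_missingU1 im' mS)).
(* If [m = i], adding [i] changes the least missing index to some [q <= i'], and the competing
   triple is [(i |: S, q, i')]. Otherwise it is [(m |: S, i, i')]. *)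
have [mE|m_i] := eqVneq m i.
  have [q qS] : exists q, least_missing (i |: S) q.
    apply: least_missing_exists; apply/eqP => /setP/(_ i').
    by rewrite !inE (negPf i'i) (negPf i'S).
  rewrite (outflow_diff mS qS) mE.
  have i'iS : i' \notin i |: S by rewrite !inE negb_or i'i.
  have [_ /(_ i' i'iS) qi'] := qS.
  have : 0 <= p i * (gap (i |: S) q i' - gap S i i').
    by rewrite mulr_ge0 ?subr_ge0 ?fmin // ltW.
  by rewrite /gap /increment [i |: (i' |: S)]setUCA; lra.
rewrite (outflow_diff mS (least_missingU1 m_i mS)).
have : 0 <= p m * (gap (m |: S) i i' - gap S i i').
  rewrite mulr_ge0 ?subr_ge0 ?fmin //; first exact: ltW.
  by rewrite !inE negb_or i'S eq_sym im'.
by rewrite /gap /increment ![m |: (_ |: S)]setUCA; lra.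
Qed.

(** At a negative minimum of [w], expansion puts the mixed second difference of the outflow below
    [p i * w S i j], while balance and monotonicity make it nonnegative. *)
Lemma increment2_ge0 (S : {set 'I_n}) (i j : 'I_n) :
  i != j -> 0 <= increment (increment phi i) j S.
Proof.
move=> ij.
pose P (U : {set 'I_n} * 'I_n * 'I_n) := U.1.2 != U.2.
pose f (U : {set 'I_n} * 'I_n * 'I_n) :=
  increment (increment phi U.1.2) U.2 U.1.1.
apply: (@minimum_principle R _ P f _ (S, i, j)) => //.
move=> [[{ij}S {}i] {}j]; rewrite {}/P {}/f /= => ij neg fmin.
pose w (T : {set 'I_n}) x y := increment (increment phi x) y T.
have {}fmin (T : {set 'I_n}) (x y : 'I_n) : x != y -> w S i j <= w T x y.
  by move=> xy; apply: (fmin (T, x, y)).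
have {neg}: w S i j < 0 by [].
wlog ltij : i j ij fmin / (i < j)%N => [wlog_ij|neg].
  have [lt_ij|lt_ji|eq_ij] := ltngtP i j; first exact: wlog_ij.
    rewrite /w incrementC; apply: wlog_ij; rewrite 1?eq_sym // => T x y xy.
    by rewrite /w incrementC fmin.
  by have := val_inj eq_ij; move/eqP; rewrite (negPf ij).
have iS : i \notin S.
  apply: contraTN neg => iS; rewrite -leNgt /w incrementC.
  by rewrite (increment_in _ iS).
have jS : j \notin S.
  apply: contraTN neg => jS; rewrite -leNgt /w.
  by rewrite (increment_in _ jS).
have iSj : i \notin j |: S by rewrite !inE negb_or ij.
have jSi : j \notin i |: S by rewrite !inE negb_or eq_sym ij.
have bound : (outflow p phi (i |: (j |: S)) - outflow p phi (i |: S))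
    - (outflow p phi (j |: S) - outflow p phi S) < p i * w S i j.
  have out_w : outflow p (increment (increment phi i) j) S <= 0.
    by apply: sumr_le0 => l _; rewrite pmulr_rle0 // subr_le0 fmin.
  have E1 := outflowU1 phi iSj; have E2 := outflowU1 phi iS.
  have E3 := outflowU1 (increment phi i) jS.
  have : p j * w S i j < 0 by rewrite pmulr_rlt0.
  have : p i * w S i j = p i * increment phi i (j |: S) - p i * increment phi i S.
    by rewrite /w [in LHS]/increment mulrBr.
  by rewrite /w; lra.
have [m mS] : exists m, least_missing S m.
  by apply: least_missing_exists; apply: contraNneq iS => ->; rewrite inE.
have [mSn mmin] := mS; have mi := mmin i iS.
have mj : m != j by apply: contraTneq ltij => <-; rewrite -leqNgt.
have wE x y T : w T x y = phi (x |: (y |: T)) - phi (y |: T)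
    - (phi (x |: T) - phi T) by [].
move: bound; apply/negP; rewrite -leNgt (outflow_diff mS (least_missingU1 mj mS)).
have wneg : p i * w S i j < 0 by rewrite pmulr_rlt0.
(* If [m] is not [i], it is the least missing index of all four sets. *)
have [mE|m_i] := eqVneq m i; last first.
  have mSi := least_missingU1 m_i mS.
  have mSij : least_missing (i |: (j |: S)) m.
    by apply: least_missingU1 => //; apply: least_missingU1.
  rewrite (outflow_diff mSi mSij).
  have : 0 <= p m * (w (m |: S) i j - w S i j).
    by rewrite mulr_ge0 ?subr_ge0 ?fmin // ltW.
  rewrite !wE /increment ![m |: (_ |: S)]setUCA [m |: (i |: _)]setUCA.
  by rewrite [m |: (j |: S)]setUCA; move: wneg; rewrite wE; lra.
rewrite {m mi mSn mmin mj}mE in mS *.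
(* Now [i] is least missing in [S] and in [j |: S], so their outflows differ by exactly
   [p i * w S i j]. *)
suff : p i * w S i j <= outflow p phi (i |: (j |: S)) - outflow p phi (i |: S).
  rewrite (_ : p i * increment phi i (j |: S) - p i * increment phi i S = p i * w S i j).
    by move: wneg; lra.
  by rewrite wE /increment; ring.
have step q : q != j -> p q * w S i j <= p q * w (i |: S) j q.
  by move=> qj; rewrite ler_pM2l // fmin // eq_sym.
have [q qS] : exists q, least_missing (i |: S) q.
  by apply: least_missing_exists; apply: contraNneq jSi => ->; rewrite inE.
have [qSi qmin] := qS; have qj := qmin j jSi.
(* As [w S i j] is negative, passing to the smaller factor [p r] can only raise the product. *)
have coarse r : r \notin i |: S -> p i * w S i j <= p r * w S i j.
  move=> rSi; rewrite ler_nM2r // p_noninc //.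
  have [_ imin] := mS; apply: imin.
  by apply: contra rSi => rS; rewrite !inE rS orbT.
have [qE|q_j] := eqVneq q j; last first.
  have qSij : least_missing (i |: (j |: S)) q.
    by rewrite setUCA; apply: least_missingU1.
  rewrite (outflow_diff qS qSij).
  apply: (le_trans (coarse q qSi)); apply: (le_trans (step q q_j)).
  by rewrite wE /increment [j |: (q |: _)]setUCA [i |: (j |: S)]setUCA; lra.
rewrite {q qj qSi qmin}qE in qS *.
have balj : p j * increment phi j (i |: S) = 1 + outflow p phi (i |: S).
  exact: phi_bal.
(* Balance fails at the full set, but there monotonicity alone suffices. *)
have [full|/least_missing_exists[r rS]] := eqVneq (i |: (j |: S)) setT.
  suff : p j * increment phi j (i |: S) <= outflow p phi (i |: (j |: S)).
    by move: wneg balj; lra.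
  rewrite /outflow (bigD1 j) //= setUCA setU1K // lerDl.
  apply: sumr_ge0 => l _; rewrite mulr_ge0 ?subr_ge0 ?phi_mono ?subsetDl //.
  exact: ltW.
have [rSij _] := rS; move: (rSij).
rewrite !inE !negb_or => /and3P[ri rj rSn].
have rSi : r \notin i |: S by rewrite !inE negb_or ri.
rewrite (outflow_diff qS rS).
apply: (le_trans (coarse r rSi)); apply: (le_trans (step r rj)).
have [_ /(_ r rSi) jr] := qS.
(* Replacing the increment at [j] by the larger scaled one at [r] bounds the outflow difference
   below by [p r * w (i |: S) j r]. *)
have := scaled_increment_le jr rSi.
by rewrite wE /increment [j |: (r |: _)]setUCA [i |: (j |: S)]setUCA; lra.
Qed.

(** By supermodularity, adding the missing indices other than [i] one at a time never lowers the
    increment. *)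
Lemma increment_le_top (S : {set 'I_n}) (i : 'I_n) :
  increment phi i S <= increment phi i ([set: 'I_n] :\ i).
Proof.
have [iS|iS] := boolP (i \in S).
  by rewrite (increment_in _ iS) increment_ge0.
elim: {S}#|~: S| {-2}S (erefl #|~: S|) iS => [|k IHk] S cS iS.
  have : i \in ~: S by rewrite inE.
  by rewrite (cards0_eq cS) inE.
have [->//|SD] := eqVneq S ([set: 'I_n] :\ i).
have [j jS ji] : exists2 j, j \notin S & j != i.
  have /subsetPn[j] : ~~ ([set: 'I_n] :\ i \subset S).
    apply: contra SD => DS; rewrite eqEsubset DS andbT.
    by apply/subsetP => x xS; rewrite !inE andbT; apply: contraNneq iS => <-.
  by rewrite !inE andbT => ji jS; exists j.
apply: (@le_trans _ _ (increment phi i (j |: S))).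
  by have := @increment2_ge0 S i j; rewrite eq_sym subr_ge0 => /(_ ji).
apply: IHk; last by rewrite !inE negb_or eq_sym ji.
by move: cS; rewrite (cardsD1 j) inE jS setUC setCU => -[<-]; rewrite setDE.
Qed.

End Balanced.

(** * The game *)

Lemma expectationS (R : realType) (k N : nat) (p : 'I_k -> R)
    (F : N.+1.-tuple 'I_k -> R) :
  expectation p F =
  \sum_i p i * expectation p (fun w : N.-tuple 'I_k => F [tuple of i :: w]).
Proof.
rewrite /expectation.
under [RHS]eq_bigr do rewrite mulr_sumr.
rewrite pair_big /=.
rewrite (reindex (fun u : 'I_k * N.-tuple 'I_k => [tuple of u.1 :: u.2])) /=.
  apply: eq_bigr => -[i w] _ /=; rewrite big_ord_recl tnth0 mulrA.
  by congr (_ * _ * _); apply: eq_bigr => t _; rewrite tnthS.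
exists (fun w => (thead w, [tuple of behead w])) => [[i w]|w] _ /=.
  by congr pair; apply: val_inj.
by rewrite [RHS]tuple_eta.
Qed.

Lemma expectationD_cst (R : realType) (k N : nat) (p : 'I_k -> R) (x : R)
    (F : N.-tuple 'I_k -> R) :
  \sum_i p i = 1 -> expectation p (fun w => x + F w) = x + expectation p F.
Proof.
move=> p1.
have mass : \sum_(w : N.-tuple 'I_k) \prod_(t < N) p (tnth w t) = 1.
  transitivity (expectation p (fun _ : N.-tuple 'I_k => 1)).
    by apply: eq_bigr => w _; rewrite mulr1.
  elim: {F}N => [|N IHN].
    rewrite /expectation (big_pred1 [tuple]) ?big_ord0 ?mulr1 // => w.
    by rewrite [w]tuple0; apply/esym/eqP.
  by rewrite expectationS; under eq_bigr do rewrite IHN mulr1.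
rewrite /expectation; under eq_bigr do rewrite mulrDr.
by rewrite big_split /= -mulr_suml mass mul1r.
Qed.

Lemma expectationBZ (R : realType) (k N : nat) (p : 'I_k -> R) (c : R)
    (F G : N.-tuple 'I_k -> R) :
  expectation p (fun w => F w - c * G w) = expectation p F - c * expectation p G.
Proof.
rewrite /expectation mulr_sumr -sumrB; apply: eq_bigr => w _.
by ring.
Qed.

Definition matched (k : nat) (X : eqType) (a d : config k X) : {set 'I_k} :=
  [set i | a i == d i].

Section Game.

Variables (R : realType) (k : nat) (X : eqType) (beta p : 'I_k -> R).
Variable phi : {set 'I_k} -> R.
Hypothesis beta_gt0 : forall i, 0 < beta i.
Hypothesis p_gt0 : forall i, 0 < p i.
Hypothesis p_sum1 : \sum_i p i = 1.
Hypothesis p_noninc : forall i j : 'I_k, (i <= j)%N -> p j <= p i.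
Hypothesis phi_mono : monotone phi.
Hypothesis phi_bal : balanced p phi.

Let P := \sum_j p j * beta j.

(** The indices of [D] are removed one at a time, each removal bounded by a top increment. *)
Lemma potential_drop (S D : {set 'I_k}) :
  phi S - phi (S :\: D) <= \sum_(i in D) increment phi i ([set: 'I_k] :\ i).
Proof.
elim: {D}#|D| {-2}D (erefl #|D|) S => [|m IHm] D cD S.
  by rewrite (cards0_eq cD) setD0 subrr big_set0.
have [i iD] : exists i, i \in D by apply/card_gt0P; rewrite cD.
rewrite (big_setD1 i) //=.
have -> : S :\: D = S :\ i :\: (D :\ i) by rewrite setDDl setD1K.
have cDi : #|D :\ i| = m by move: cD; rewrite (cardsD1 i) iD => -[].
have := IHm _ cDi (S :\ i); have := increment_ge0 phi_mono i (S :\ i).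
have := increment_le_top p_gt0 phi_mono phi_bal p_noninc (S :\ i) i.
have : phi S <= phi (i |: S :\ i).
  by apply: phi_mono; apply/subsetP => x xS; rewrite !inE xS andbT orbN.
by rewrite {1 3}/increment; lra.
Qed.

(** Moving server [i] can destroy only the match at [i], which is charged to [beta i]; new matches
    can only raise [phi]. *)
Lemma adversary_move (c : R) (a d d' : config k X) :
  (forall i, P * increment phi i ([set: 'I_k] :\ i) <= c * beta i) ->
  P * (phi (matched a d) - phi (matched a d')) <= c * move_cost beta d d'.
Proof.
move=> Pc; pose D := [set i | d i != d' i].
have P0 : 0 <= P by apply: sumr_ge0 => j _; rewrite mulr_ge0 // ltW.
have sub : matched a d :\: D \subset matched a d'.
  by apply/subsetP => i; rewrite !inE negbK => /andP[/eqP <-].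
apply: (@le_trans _ _ (P * \sum_(i in D) increment phi i ([set: 'I_k] :\ i))).
  rewrite ler_wpM2l //; apply: le_trans (potential_drop (matched a d) D).
  by rewrite lerB // phi_mono.
rewrite /move_cost !mulr_sumr big_mkcond /=; apply: ler_sum => i _.
by rewrite /uniform_dist !inE; case: ifP => _; rewrite ?mulr1 ?mulr0.
Qed.

(** Equality holds at the least missing index, where the scaled increment is smallest. *)
Lemma increment_drift (S : {set 'I_k}) (x : 'I_k) :
  x \notin S -> 1 + outflow p phi S <= p x * increment phi x S.
Proof.
move=> xS.
have [m mS] : exists m, least_missing S m.
  by apply: least_missing_exists; apply: contraNneq xS => ->; rewrite inE.
have [_ /(_ x xS) mx] := mS.
by rewrite -(phi_bal mS) scaled_increment_le.
Qed.

(** An answer to an unoccupied request costs [P] on average and raises [phi] by at least 1 on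
    average; at an occupied one both sides vanish. *)
Lemma algorithm_move (a d : config k X) (r : X) :
  occupied d r ->
  \sum_i p i * move_cost beta a (alg_step a r i) <=
  P * (\sum_i p i * phi (matched (alg_step a r i) d) - phi (matched a d)).
Proof.
move=> /existsP[x /eqP dx].
have P0 : 0 <= P by apply: sumr_ge0 => j _; rewrite mulr_ge0 // ltW.
rewrite /alg_step; have [ar|ar] := boolP (occupied a r) => /=.
  rewrite -!mulr_suml p_sum1 !mul1r subrr mulr0 /move_cost big1 // => j _.
  by rewrite /uniform_dist eqxx mulr0.
have aNr i : a i != r by apply: contra ar => ai; apply/existsP; exists i.
set S := matched a d.
pose T i := matched (fun j => if j == i then r else a j) d.
have xS : x \notin S by rewrite inE dx aNr.
(* Moving server [i] can spoil only the match at [i], while moving server [x] creates one, since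
   [d x = r]. *)
have subT i : S :\ i \subset T i.
  by apply/subsetP => j; rewrite !inE => /andP[/negPf ->].
have subTx : x |: S \subset T x.
  apply/subsetP => j; rewrite !inE => /predU1P[->|]; first by rewrite eqxx dx.
  by case: (eqVneq j x) => [->|//]; rewrite dx eqxx.
apply: (@le_trans _ _ (P * 1)).
  rewrite mulr1; apply: ler_sum => i _; rewrite ler_wpM2l //; first exact: ltW.
  rewrite /move_cost (bigD1 i) //= eqxx big1 => [|j /negPf ->].
    by rewrite addr0 /uniform_dist aNr mulr1.
  by rewrite /uniform_dist eqxx mulr0.
rewrite ler_wpM2l //.
have drift := increment_drift xS.
have out : outflow p phi S = \sum_(l | l != x) p l * (phi S - phi (S :\ l)).
  rewrite /outflow (bigD1 x) //= (_ : S :\ x = S) ?subrr ?mulr0 ?add0r //.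
  by apply/setDidPl; rewrite disjoint_sym disjoints1.
have -> : \sum_i p i * phi (T i) - phi S = \sum_i p i * (phi (T i) - phi S).
  under [RHS]eq_bigr do rewrite mulrBr.
  by rewrite sumrB -mulr_suml p_sum1 mul1r.
rewrite (bigD1 x) //=.
have le_x : p x * increment phi x S <= p x * (phi (T x) - phi S).
  by rewrite ler_pM2l // lerB // phi_mono.
have le_l : - outflow p phi S <= \sum_(l | l != x) p l * (phi (T l) - phi S).
  rewrite out -sumrN; apply: ler_sum => l _; rewrite -mulrN opprB ler_pM2l //.
  by rewrite lerB // phi_mono.
by lra.
Qed.

(** Arbitrary history and configurations make the induction on [N] work. The adversary's move is
    charged against [a], then the answer against [d']; a stopped run leaves a nonnegative
    potential. *)
Lemma run_cost_bound (c : R) (A : adversary k X) (N : nat)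
    (h : seq (config k X)) (a d : config k X) :
  (forall i, P * increment phi i ([set: 'I_k] :\ i) <= c * beta i) ->
  expectation p (fun w : N.-tuple 'I_k =>
    (run_cost beta A h a d w).1 - c * (run_cost beta A h a d w).2)
  <= P * (phi [set: 'I_k] - phi (matched a d)).
Proof.
move=> Pc.
have P0 : 0 <= P by apply: sumr_ge0 => j _; rewrite mulr_ge0 // ltW.
have bound0 S : 0 <= P * (phi [set: 'I_k] - phi S).
  by rewrite mulr_ge0 // subr_ge0 phi_mono ?subsetT.
elim: N h a d => [|N IHN] h a d.
  rewrite /expectation big1 // => w _.
  by rewrite [w]tuple0 /= mulr0 subrr mulr0.
rewrite expectationS /=; case Ah: (A h) => [[r d']|]; last first.
  rewrite big1 // => i _; rewrite /expectation big1 => [|w _] /=; first exact: mulr0.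
  by rewrite mulr0 subrr mulr0.
have dr := adv_serves Ah.
have advm := adversary_move a d d' Pc.
have algm := algorithm_move a dr.
apply: (@le_trans _ _ (\sum_i p i * ((move_cost beta a (alg_step a r i) -
    c * move_cost beta d d') +
    P * (phi [set: 'I_k] - phi (matched (alg_step a r i) d'))))).
  apply: ler_sum => i _; rewrite ler_pM2l //.
  apply: le_trans (lerD (lexx _) (IHN (rcons h (alg_step a r i)) (alg_step a r i) d')).
  rewrite -expectationD_cst // le_eqVlt; apply/orP; left; apply/eqP.
  by apply: eq_bigr => w _ /=; congr (_ * _); ring.
have -> : \sum_i p i * ((move_cost beta a (alg_step a r i) -
    c * move_cost beta d d') +
    P * (phi [set: 'I_k] - phi (matched (alg_step a r i) d'))) =
  \sum_i p i * move_cost beta a (alg_step a r i) +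
  (\sum_i p i) * (P * phi [set: 'I_k] - c * move_cost beta d d') -
  P * \sum_i p i * phi (matched (alg_step a r i) d').
  rewrite mulr_suml mulr_sumr -big_split -sumrB /=; apply: eq_bigr => i _.
  by ring.
rewrite p_sum1 mul1r; lra.
Qed.

End Game.

Theorem theorem3 (R : realType) (n : nat) (X : eqType)
    (beta p : 'I_n.+1 -> R)
    (beta_gt0 : forall i, 0 < beta i)
    (p_gt0 : forall i, 0 < p i)
    (p_sum1 : \sum_(i < n.+1) p i = 1)
    (p_noninc : forall i j : 'I_n.+1, (i <= j)%N -> p j <= p i) :
  competitive X beta p (alpha_tilde beta p).
Proof.
have mono := potential_monotone p_gt0; have bal := potential_balanced p_gt0.
set phi := potential p in mono bal.
(* The factor [p i] of the current cancels, so each ratio is a top increment divided by [beta i]. *)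
have alphaP i : (\sum_j p j * beta j) * increment phi i ([set: 'I_n.+1] :\ i) <=
    alpha_tilde beta p * beta i.
  rewrite /alpha_tilde -mulrA ler_wpM2l //.
    by apply: sumr_ge0 => j _; rewrite mulr_ge0 // ltW.
  rewrite -ler_pdivrMr //; apply: le_trans (le_bigmax _ _ i).
  rewrite /current /current_of /increment setD1K ?inE //.
  by rewrite -mulf_div divff ?mul1r // lt0r_neq0.
(* The constant is 0 because equal initial configurations make the matched set full and the initial
   potential zero. *)
exists 0 => a0 A N; rewrite addr0 -subr_le0 -expectationBZ.
apply: (le_trans (run_cost_bound beta_gt0 p_gt0 p_sum1 p_noninc mono bal
  A N [::] a0 a0 alphaP)).
rewrite (_ : matched a0 a0 = setT) ?subrr ?mulr0 //.
by apply/setP => i; rewrite !inE eqxx.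
Qed.
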